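(* For every $n\ge 5$, the wheel graph $W_n$ with $n$ vertices satisfies \[ \operatorname{nim}(\mathrm{TER}(W_n))=\begin{cases} 2, & n \bmod 34 \in \{5,6,10,11,25,26,30,31\}\\ 1, & \text{otherwise}. \end{cases} \]
   Context: $W_n$ is the graph on $n$ vertices $v_1,\dots,v_{n-1},c$, where the center $c$ is adjacent to every $v_i$, and $v_i$ is adjacent to $v_{i+1}$ (indices modulo $n-1$). For a graph $G$ with vertex set $V$, a set $K\subseteq V$ is convex if it contains every vertex lying on any shortest path between two elements of $K$. The convex hull $[P]$ of $P\subseteq V$ is the smallest convex set containing $P$. The game $\mathrm{TER}(G)$: positions are the sets $P\subseteq V$ reachable from the starting position $\emptyset$ by the following moves. If $[V\setminus P]=V$, then the options of $P$ are all sets $P\cup\{v\}$ with $v\in V\setminus P$; if $[V\setminus P]\neq V$, then $P$ is terminal (has no options). The nim-value of a position is defined recursively by $\operatorname{nim}(p)=\operatorname{mex}\{\operatorname{nim}(q): q\text{ an option of }p\}$, where $\operatorname{mex}(A)$ is the smallest nonnegative integer not in $A$; the nim-value of a game is that of its starting position. *)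

(* Defs.v *)
From mathcomp Require Import all_boot.
From mathcomp Require Import boolp.

Set Implicit Arguments.
Unset Strict Implicit.
Unset Printing Implicit Defensive.

(* A simple graph on a finite type T is given by its adjacency relation       *)
(* e : rel T, symmetric and irreflexive.                                      *)

Section Convexity.
Variables (T : finType) (e : rel T).

(* As in path.v, the walk is x :: p, of length size p. *)
Definition walk_between (x y : T) (p : seq T) : bool :=
  path e x p && (last x p == y).

Definition shortest_path (x y : T) (p : seq T) : Prop :=
  walk_between x y p /\
  forall q : seq T, walk_between x y q -> size p <= size q.

Definition convex (K : {set T}) : Prop :=
  forall x y : T, x \in K -> y \in K ->
  forall p : seq T, shortest_path x y p -> {subset x :: p <= K}.

Definition hull (P : {set T}) : {set T} :=
  \bigcap_(K : {set T} | `[< convex K >] && (P \subset K)) K.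

Lemma sub_hull (P : {set T}) : P \subset hull P.
Proof. by apply/bigcapsP => K /andP[]. Qed.

Lemma hull_convex (P : {set T}) : convex (hull P).
Proof.
move=> x y /bigcapP hx /bigcapP hy p xyp z zp; apply/bigcapP => K hK.
have /andP[/asboolP cK _] := hK.
exact: (cK x y (hx K hK) (hy K hK) p xyp).
Qed.

Lemma hull_min (P K : {set T}) : convex K -> P \subset K -> hull P \subset K.
Proof. by move=> cK PK; apply: bigcap_inf; rewrite PK andbT; apply/asboolP. Qed.

End Convexity.

Lemma mex_subproof (s : seq nat) : exists n, n \notin s.
Proof.
exists (\max_(m <- s) m).+1; apply/negP => /(@leq_bigmax_seq _ s predT id).
by rewrite ltnn => /(_ isT).
Qed.

Definition mex (s : seq nat) : nat := ex_minn (mex_subproof s).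

Section Terminate.
Variables (T : finType) (e : rel T).

(* Defined on all sets P; the nim-value of set0 depends only on the sets      *)
(* reachable from it, which are the positions of the game.                    *)
Definition ter_options (P : {set T}) : seq {set T} :=
  if hull e (~: P) == [set: T] then [seq v |: P | v <- enum (~: P)] else [::].

(* Every move shrinks ~: P, so #|~: P| bounds the length of any play from P;  *)
(* with this fuel the recursion is never cut short, see ter_nimE.             *)
Fixpoint ter_nim_rec (fuel : nat) (P : {set T}) : nat :=
  if fuel is k.+1 then mex [seq ter_nim_rec k Q | Q <- ter_options P] else 0.

Definition ter_nim (P : {set T}) : nat := ter_nim_rec #|~: P| P.

Lemma ter_nimE (P : {set T}) :
  ter_nim P = mex [seq ter_nim Q | Q <- ter_options P].
Proof.
rewrite /ter_nim; case def_k: #|~: P| => [|k] /=; last first.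
  congr mex; apply/eq_in_map => Q; rewrite /ter_options; case: ifP => // _.
  case/mapP => v; rewrite mem_enum => vP ->; congr ter_nim_rec.
  have -> : ~: (v |: P) = (~: P) :\ v.
    by apply/setP => x; rewrite !inE negb_or.
  by move: def_k; rewrite (cardsD1 v) vP add1n => -[].
have -> : ter_options P = [::].
  rewrite /ter_options (cards0_eq def_k).
  by case: ifP => // _; rewrite enum_set0.
by rewrite /mex; case: ex_minnP => m _ /(_ 0 isT); rewrite leqn0 => /eqP.
Qed.

Definition nim_TER : nat := ter_nim set0.

End Terminate.

(* Some i is the rim vertex v_(i+1), for i < n - 1; None is the center c.     *)
(* ordS is the successor modulo n - 1.                                        *)
Definition wheel (n : nat) : rel (option 'I_n.-1) := fun x y =>
  match x, y with
  | Some i, Some j => (j == ordS i) || (i == ordS j)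
  | None, None => false
  | _, _ => true
  end.
Arguments wheel n : clear implicits.

Lemma card_wheel (n : nat) : 0 < n -> #|{: option 'I_n.-1}| = n.
Proof. by move=> n_gt0; rewrite card_option card_ord prednK. Qed.

Lemma wheel_sym (n : nat) : symmetric (wheel n).
Proof. by move=> [i|] [j|] //=; rewrite orbC. Qed.

Lemma wheel_irr (n : nat) : 2 < n -> irreflexive (wheel n).
Proof.
move=> n_gt2 [i|] //=; rewrite orbb; apply/negP => /eqP/(congr1 val) /=.
case: n n_gt2 i => [|[|[|n]]] //= _ i.
have := ltn_ord i; rewrite ltnS leq_eqVlt => /orP[/eqP -> | lt_i].
  by rewrite modnn.
by rewrite modn_small ?ltnS // => /eqP; rewrite ltn_eqF.
Qed.

(* Main.v *)
(**
Removing P leaves a set whose hull is everything exactly when no two adjacent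
rim vertices lie in P. So once a rim vertex has been taken, taking one of its
neighbours ends the game with value 0, and discarding these moves leaves node
Kayles on the vertices that are neither taken nor adjacent on the rim to a
taken one: the nim-value is one more than that of node Kayles. After the first
rim move this node Kayles consists of the center, now isolated, and a path of
n - 4 vertices, while taking the center first yields value 0. Hence the value
of the empty position is 2 if a path of n - 4 vertices has Kayles value 1, and
1 otherwise. The Kayles values of paths (Dawson's Kayles) have period 34 from
52 on, and the value 1 occurs in that period as the theorem says.
*)
Require Import Defs.
From Stdlib Require Import PeanoNat.
From mathcomp Require Import all_boot.
From mathcomp Require Import zify.

Set Implicit Arguments.
Unset Strict Implicit.
Unset Printing Implicit Defensive.

(** * Minimal excludants *)

Lemma mex_notin (s : seq nat) : mex s \notin s.
Proof. by rewrite /mex; case: ex_minnP. Qed.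

Lemma mem_lt_mex (s : seq nat) k : k < mex s -> k \in s.
Proof.
rewrite /mex; case: ex_minnP => m _ min_m lt_km.
by apply: contraLR lt_km => /min_m; rewrite -leqNgt.
Qed.

Lemma mex_unique (s : seq nat) m :
  m \notin s -> (forall k, k < m -> k \in s) -> mex s = m.
Proof.
move=> ms lts; case: (ltngtP (mex s) m) => // [/lts|/mem_lt_mex].
  by rewrite (negPf (mex_notin s)).
by rewrite (negPf ms).
Qed.

Lemma eq_mem_mex (s t : seq nat) : s =i t -> mex s = mex t.
Proof.
move=> st; apply: mex_unique => [|k lt_k]; first by rewrite st mex_notin.
by rewrite st mem_lt_mex.
Qed.

(** This is how a game's value rises by one when each of its positions gains a move that ends the
    play. *)
Lemma mex_cons0 (s : seq nat) : mex (0 :: map S s) = (mex s).+1.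
Proof.
apply: mex_unique => [|[|k] lt_k]; rewrite inE //=.
  by rewrite mem_map ?mex_notin //; apply: succn_inj.
by rewrite mem_map ?mem_lt_mex //; apply: succn_inj.
Qed.

(** By pigeonhole, one of the [size s + 1] candidates is missing from [s]. The bounded search makes
    [mex] computable. *)
Lemma mex_find (s : seq nat) :
  mex s = find (fun k => k \notin s) (iota 0 (size s).+1).
Proof.
set P := fun k => _; set r := iota _ _.
have hasP : has P r.
  apply/negPn/negP => /hasPn noP.
  have : size r <= size s.
    by apply: uniq_leq_size (iota_uniq _ _) _ => k /noP /negPn.
  by rewrite size_iota ltnn.
have ltf : find P r < (size s).+1 by rewrite -[X in _ < X](size_iota 0) -has_find.
apply: mex_unique => [|k lt_k].
  by have := nth_find 0 hasP; rewrite nth_iota.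
have := before_find 0 lt_k; rewrite nth_iota ?add0n; last exact: ltn_trans ltf.
by move/negbFE.
Qed.

(** * Nim-sums *)

Lemma lt_testbit a b k :
    Nat.testbit a k -> ~~ Nat.testbit b k ->
    (forall i, k < i -> Nat.testbit a i = Nat.testbit b i) -> b < a.
Proof.
elim: k a b => [|k IHk] a b ak bk eq_hi.
  have eq_half : Nat.div2 a = Nat.div2 b.
    by apply: Nat.bits_inj => i; rewrite !Nat.testbit_div2 eq_hi.
  have := Nat.div2_odd a; have := Nat.div2_odd b.
  move: ak bk; rewrite /is_true !Nat.bit0_odd => -> /negbTE ->.
  by rewrite eq_half /=; lia.
have lt_half : Nat.div2 b < Nat.div2 a.
  apply: IHk; rewrite ?Nat.testbit_div2 // => i lt_ki.
  by rewrite !Nat.testbit_div2 eq_hi.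
have := Nat.div2_odd a; have := Nat.div2_odd b.
case: (Nat.odd a); case: (Nat.odd b) => /=; lia.
Qed.

(** Let [k] be the highest bit where [z] differs from the nim-sum of [x] and [y]. As [z] is smaller,
    bit [k] is set in the nim-sum and not in [z], so exactly one of [x] and [y] has it. Replacing
    that one clears bit [k] and keeps all higher bits. *)
Lemma lxor_lt_cases x y z :
  z < Nat.lxor x y -> Nat.lxor z y < x \/ Nat.lxor z x < y.
Proof.
move=> lt_z; set d := Nat.lxor z (Nat.lxor x y).
have d_neq0 : d <> 0 by move/Nat.lxor_eq => eq_z; rewrite -eq_z ltnn in lt_z.
have dk := Nat.bit_log2 d d_neq0.
have dhi i : Nat.log2 d < i -> Nat.testbit d i = false.
  by move=> lt_i; apply: Nat.bits_above_log2; apply/ltP.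
move: (Nat.log2 d) dk dhi => k; rewrite /d !Nat.lxor_spec => dk dhi.
have {}dhi i : k < i ->
    Nat.testbit z i = xorb (Nat.testbit x i) (Nat.testbit y i).
  by move/dhi; rewrite !Nat.lxor_spec; do 3!case: Nat.testbit.
have zk : ~~ Nat.testbit z k.
  apply/negP => zk; suff: Nat.lxor x y < z by lia.
  apply: (@lt_testbit _ _ k) => // [|i /dhi]; rewrite Nat.lxor_spec //.
  set b := xorb _ _; by rewrite zk in dk; move: dk; rewrite -/b; case: b.
have [xk|xk] := boolP (Nat.testbit x k); [left|right];
  apply: (@lt_testbit _ _ k); rewrite ?Nat.lxor_spec //.
- by move: dk; rewrite xk (negPf zk); case: Nat.testbit.
- by move=> i /dhi; rewrite Nat.lxor_spec => ->; do 2!case: Nat.testbit.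
- by move: dk; rewrite (negPf xk) (negPf zk); case: Nat.testbit.
- by rewrite (negPf xk) (negPf zk).
- by move=> i /dhi; rewrite Nat.lxor_spec => ->; do 2!case: Nat.testbit.
Qed.

Lemma lxorKr x y : Nat.lxor (Nat.lxor x y) y = x.
Proof. by rewrite Nat.lxor_assoc Nat.lxor_nilpotent Nat.lxor_0_r. Qed.

Lemma mex_lxor (s t : seq nat) :
  mex ([seq Nat.lxor x (mex t) | x <- s] ++ [seq Nat.lxor (mex s) y | y <- t])
  = Nat.lxor (mex s) (mex t).
Proof.
apply: mex_unique => [|z /lxor_lt_cases lt_z].
  rewrite mem_cat; apply/norP; split; apply/mapP => -[u us].
    move/(congr1 (Nat.lxor^~ (mex t))); rewrite !lxorKr => eq_u.
    by move: (mex_notin s); rewrite eq_u us.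
  rewrite ![Nat.lxor (mex s) _]Nat.lxor_comm.
  move/(congr1 (Nat.lxor^~ (mex s))); rewrite !lxorKr => eq_u.
  by move: (mex_notin t); rewrite eq_u us.
rewrite mem_cat; apply/orP; case: lt_z => /mem_lt_mex lt_z; [left|right].
  by apply/mapP; exists (Nat.lxor z (mex t)); rewrite ?lxorKr.
apply/mapP; exists (Nat.lxor z (mex s)) => //.
by rewrite Nat.lxor_comm lxorKr.
Qed.

(** * Node Kayles *)

Section NodeKayles.
Variables (T : finType) (a : rel T).
Hypotheses (a_refl : reflexive a) (a_sym : symmetric a).

(** As [a] is reflexive, a move deletes the chosen vertex along with its neighbours, so [#|U|] is
    enough fuel. *)
Fixpoint node_kayles_rec (fuel : nat) (U : {set T}) : nat :=
  if fuel is k.+1 then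
    mex [seq node_kayles_rec k (U :\: [set x | a v x]) | v <- enum U]
  else 0.

Definition node_kayles (U : {set T}) : nat := node_kayles_rec #|U| U.

Lemma card_delete_nbhd (U : {set T}) v :
  v \in U -> #|U :\: [set x | a v x]| < #|U|.
Proof.
move=> vU; apply: proper_card; apply/properP; split; first exact: subsetDl.
by exists v; rewrite // !inE a_refl.
Qed.

Lemma node_kayles_rec_fuel k (U : {set T}) :
  #|U| <= k -> node_kayles_rec k U = node_kayles U.
Proof.
rewrite /node_kayles; have [l] := ubnP k; elim: l => // l IHl in k U *.
case: k => [|k] /= lt_kl leU; first by move: leU; rewrite leqn0 => /eqP ->.
case defU: #|U| => [|u] /=.
  by rewrite (cards0_eq defU) enum_set0 /=; apply: mex_unique.
congr mex; apply/eq_in_map => v; rewrite mem_enum => /card_delete_nbhd ltU.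
by rewrite !IHl //; lia.
Qed.

Lemma node_kaylesE (U : {set T}) :
  node_kayles U = mex [seq node_kayles (U :\: [set x | a v x]) | v <- enum U].
Proof.
rewrite -(node_kayles_rec_fuel (leqnSn _)) /=; congr mex; apply/eq_in_map => v.
rewrite mem_enum => /card_delete_nbhd ltU.
by rewrite node_kayles_rec_fuel // ltnW.
Qed.

(** A move in one part leaves the other intact, so the options are those of a sum and [mex_lxor]
    applies. *)
Lemma node_kaylesU (A B : {set T}) :
    (forall x y, x \in A -> y \in B -> ~~ a x y) ->
  node_kayles (A :|: B) = Nat.lxor (node_kayles A) (node_kayles B).
Proof.
have [l] := ubnP (#|A| + #|B|); elim: l => // l IHl in A B * => ltl nAB.
rewrite [LHS]node_kaylesE [node_kayles A]node_kaylesE [node_kayles B]node_kaylesE.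
rewrite -mex_lxor -(node_kaylesE A) -(node_kaylesE B) -!map_comp; apply: eq_mem_mex.
pose N v := [set x | a v x].
have delA v : v \in A -> (A :|: B) :\: N v = (A :\: N v) :|: B.
  move=> vA; apply/setP => x; rewrite !inE.
  by case xB: (x \in B); rewrite ?orbT ?orbF // andbT nAB.
have delB v : v \in B -> (A :|: B) :\: N v = A :|: (B :\: N v).
  move=> vB; apply/setP => x; rewrite !inE.
  by case xA: (x \in A); rewrite //= andbT a_sym nAB.
have valA v : v \in A -> node_kayles ((A :|: B) :\: N v) =
    Nat.lxor (node_kayles (A :\: N v)) (node_kayles B).
  move=> vA; rewrite delA // IHl //.
    by have := card_delete_nbhd vA; rewrite -/(N v); lia.
  by move=> x y; rewrite inE => /andP[_]; apply: nAB.
have valB v : v \in B -> node_kayles ((A :|: B) :\: N v) =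
    Nat.lxor (node_kayles A) (node_kayles (B :\: N v)).
  move=> vB; rewrite delB // IHl //.
    by have := card_delete_nbhd vB; rewrite -/(N v); lia.
  by move=> x y xA; rewrite inE => /andP[_]; apply: nAB.
move=> k; rewrite mem_cat; apply/mapP/orP => [[v]|].
  rewrite mem_enum inE => /orP[] vU ->; [left|right]; apply/mapP; exists v.
  - by rewrite mem_enum.
  - by rewrite valA.
  - by rewrite mem_enum.
  - by rewrite valB.
case=> /mapP[v]; rewrite mem_enum => vU ->; exists v.
- by rewrite mem_enum inE vU.
- by rewrite valA.
- by rewrite mem_enum inE vU orbT.
- by rewrite valB.
Qed.

Lemma node_kayles1 v : node_kayles [set v] = 1.
Proof.
rewrite node_kaylesE enum_set1 /=.
have -> : [set v] :\: [set x | a v x] = set0.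
  by apply/setP => x; rewrite !inE andbC; case: eqP => // ->; rewrite a_refl.
by rewrite node_kaylesE enum_set0 /= !mex_find.
Qed.

End NodeKayles.

(** * Dawson's Kayles *)

(** A table of the first [k] values turns the course-of-values recursion into a structural one; the
    default of [nth] is never read. *)
Fixpoint kayles_seq (k : nat) : seq nat :=
  if k is l.+1 then
    let s := kayles_seq l in
    rcons s (mex [seq Nat.lxor (nth 0 s j.-1) (nth 0 s (l - j.+2))
                 | j <- iota 0 l])
  else [::].

Definition kayles (k : nat) : nat := nth 0 (kayles_seq k.+1) k.

Lemma size_kayles_seq k : size (kayles_seq k) = k.
Proof. by elim: k => //= k IHk; rewrite size_rcons IHk. Qed.

Lemma nth_kayles_seq k i : i < k -> nth 0 (kayles_seq k) i = kayles i.
Proof.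
elim: k => // k IHk; rewrite ltnS leq_eqVlt => /orP[/eqP -> //|lt_ik].
by rewrite /= nth_rcons size_kayles_seq lt_ik IHk.
Qed.

(* Truncation makes j.-1 and k - j.+2 vanish when j is an end of the path. *)
Lemma kaylesE k :
  kayles k =
  mex [seq Nat.lxor (kayles j.-1) (kayles (k - j.+2)) | j <- iota 0 k].
Proof.
rewrite {1}/kayles /= nth_rcons size_kayles_seq ltnn eqxx; congr mex.
by apply/eq_in_map => j; rewrite mem_iota => j_lt; rewrite !nth_kayles_seq //; lia.
Qed.

(* mex itself does not reduce, its termination witness being opaque. *)
Fixpoint find_kayles_seq (k : nat) : seq nat :=
  if k is l.+1 then
    let s := find_kayles_seq l in
    let t := [seq Nat.lxor (nth 0 s j.-1) (nth 0 s (l - j.+2))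
             | j <- iota 0 l] in
    rcons s (find (fun x => x \notin t) (iota 0 (size t).+1))
  else [::].

Lemma kayles_seq_find k : kayles_seq k = find_kayles_seq k.
Proof. by elim: k => //= k ->; rewrite mex_find. Qed.

(* The two parts left by a move on a path of at least 140 vertices cannot both
   be too short for the induction hypothesis, which shifts the long one by 34. *)
Lemma kayles_period k : 52 <= k -> kayles (k + 34) = kayles k.
Proof.
(* This covers 52 <= i < 140, so the table must reach index 139 + 34 = 173. *)
have base : all (fun i => kayles (i + 34) == kayles i) (iota 52 88).
  suff: let s := kayles_seq 174 in
        all (fun i => nth 0 s (i + 34) == nth 0 s i) (iota 52 88).
    move=> /allP Hi; apply/allP => i i_in; move: (Hi i i_in).
    by move: i_in; rewrite mem_iota => i_lt; rewrite !nth_kayles_seq //; lia.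
  by rewrite kayles_seq_find; vm_compute.
have [l] := ubnP k; elim: l => // l IHl in k * => lt_kl ge_k.
have [lt_k|le_k] := ltnP k 140.
  by apply/eqP/(allP base); rewrite mem_iota; lia.
have IH x : 52 <= x -> x < k -> kayles (x + 34) = kayles x.
  by move=> ge_x lt_x; apply: IHl => //; lia.
rewrite !kaylesE; apply: eq_mem_mex => v; apply/mapP/mapP => -[j];
  rewrite mem_iota => lt_j ->.
(* If the right part [k - j.+2] has at least 52 vertices, it absorbs the shift. Otherwise
   [j >= k - 53 >= 87], and the left part keeps at least 52 vertices after losing 34; this is where
   140 comes from. *)
- have [le_j|lt_j'] := leqP (j + 54) k.
    exists j; first by rewrite mem_iota; lia.
    by rewrite -(IH (k - j.+2)) 1?[k - _ + 34](_ : _ = k + 34 - j.+2) //; lia.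
  exists (j - 34); first by rewrite mem_iota; lia.
  rewrite -(IH (j - 34).-1); try lia.
  by congr (Nat.lxor (kayles _) (kayles _)); lia.
- have [le_j|lt_j'] := leqP (j + 54) k.
    exists j; first by rewrite mem_iota; lia.
    by rewrite -(IH (k - j.+2)) 1?[k - _ + 34](_ : _ = k + 34 - j.+2) //; lia.
  exists (j + 34); first by rewrite mem_iota; lia.
  rewrite -(IH j.-1); try lia.
  by congr (Nat.lxor (kayles _) (kayles _)); lia.
Qed.

(** The value 1 occurs at the same residues before the period sets in, so no lower bound on [k]
    appears. Periodicity reduces to [k < 86 = 52 + 34], where the table decides. *)
Lemma kayles_eq1 k :
  (kayles k == 1) = (k %% 34 \in [:: 1; 2; 6; 7; 21; 22; 26; 27]).
Proof.
have [l] := ubnP k; elim: l => // l IHl in k * => lt_kl.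
have [lt_k|le_k] := ltnP k 86; last first.
  have -> : k = (k - 34) + 34 by lia.
  by rewrite kayles_period ?IHl ?modnDr //; lia.
rewrite -(nth_kayles_seq lt_k) kayles_seq_find.
move: k lt_k {lt_kl}.
suff: let s := find_kayles_seq 86 in all (fun k => (nth 0 s k == 1) ==
    (k %% 34 \in [:: 1; 2; 6; 7; 21; 22; 26; 27])) (iota 0 86).
  by move=> /allP H k lt_k; apply: eqP (H k _); rewrite mem_iota.
by vm_compute.
Qed.

(** * Node Kayles on paths *)

Section Path.
Variables (T : finType) (a : rel T).
Hypotheses (a_refl : reflexive a) (a_sym : symmetric a).
Variables (N : nat) (f : nat -> T).
Hypothesis a_path : forall i j, i < N -> j < N ->
  a (f i) (f j) = (i <= j.+1) && (j <= i.+1).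

(** A move at position [j] leaves two segments with no edge between them. The guard [0 < k] admits
    an empty right segment, whose nominal start [l + j.+2] may exceed [N]. *)
Lemma node_kayles_path l k :
  (0 < k -> l + k <= N) -> node_kayles a [set x in map f (iota l k)] = kayles k.
Proof.
have [b] := ubnP k; elim: b => // b IHb in l k * => lt_kb le_lk.
rewrite node_kaylesE // kaylesE.
have del j : j < k ->
    [set x in map f (iota l k)] :\: [set x | a (f (l + j)) x] =
    [set x in map f (iota l j.-1)] :|:
    [set x in map f (iota (l + j.+2) (k - j.+2))].
  move=> lt_jk; apply/setP => x; rewrite !inE.
  apply/andP/orP => [[nax /mapP[i]]|].
    rewrite mem_iota => i_in x_def; move: nax; rewrite x_def a_path; try lia.
    move=> nax; have [lt_i|ge_i] := ltnP i (l + j); [left|right];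
      by apply: map_f; rewrite mem_iota; lia.
  by case=> /mapP[i]; rewrite mem_iota => i_in ->; rewrite a_path; try lia;
    split; [lia| apply: map_f; rewrite mem_iota; lia
           |lia| apply: map_f; rewrite mem_iota; lia].
have val j : j < k ->
    node_kayles a ([set x in map f (iota l k)] :\: [set x | a (f (l + j)) x]) =
    Nat.lxor (kayles j.-1) (kayles (k - j.+2)).
  move=> lt_jk; rewrite del // node_kaylesU //; last first.
    move=> x y; rewrite !inE => /mapP[i + ->] /mapP[i' + ->].
    by rewrite !mem_iota => i_in i'_in; rewrite a_path; lia.
  by rewrite !IHb //; lia.
apply: eq_mem_mex => v; apply/mapP/mapP => [[x]|[j]].
  rewrite mem_enum inE => /mapP[i]; rewrite mem_iota => i_in -> ->.
  exists (i - l); first by rewrite mem_iota; lia.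
  by rewrite -val ?subnKC //; lia.
rewrite mem_iota => j_in ->; exists (f (l + j)).
  by rewrite mem_enum inE; apply: map_f; rewrite mem_iota; lia.
by rewrite val; lia.
Qed.

End Path.

(** * The game on the wheel *)

Section ShortestPath.
Variables (T : finType) (e : rel T).

Lemma shortest_path2 (x y z : T) :
  x != y -> ~~ e x y -> e x z -> e z y -> shortest_path e x y [:: z; y].
Proof.
move=> neq_xy nxy xz zy; split; first by rewrite /walk_between /= xz zy /=.
case=> [|u [|? ?]] //; rewrite /walk_between /=; first by rewrite (negPf neq_xy).
by case/andP => /andP[xu _] /eqP u_y; rewrite u_y (negPf nxy) in xu.
Qed.

Lemma shortest_pathP (x y c : T) p :
    (x != y -> ~~ e x y -> e x c && e c y) -> shortest_path e x y p ->
  {subset x :: p <= [:: x; y]} \/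
  exists2 z, p = [:: z; y] & [/\ x != y, ~~ e x y, e x z & e z y].
Proof.
move=> xcy [/andP[xp /eqP last_p] min_p].
have [x_y|neq_xy] := eqVneq x y.
  have := min_p [::]; rewrite /walk_between /= x_y eqxx => /(_ isT).
  by case: p {xp last_p min_p} => // _; left=> z; rewrite !inE => ->.
have [exy|nexy] := boolP (e x y).
  have := min_p [:: y]; rewrite /walk_between /= exy eqxx => /(_ isT).
  case: p xp last_p {min_p} => [|u [|? ?]] //=.
    by move=> _ /eqP; rewrite (negPf neq_xy).
  by move=> _ -> _; left.
have /andP[xc cy] := xcy neq_xy nexy.
have := min_p [:: c; y]; rewrite /walk_between /= xc cy eqxx => /(_ isT).
case: p xp last_p {min_p} => [|z [|u [|? ?]]] //=.
- by move=> _ x_y; rewrite x_y eqxx in neq_xy.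
- by rewrite andbT => xz z_y; rewrite z_y (negPf nexy) in xz.
by case/and3P=> xz zu _ u_y _; right; exists z; rewrite -?u_y.
Qed.

End ShortestPath.

(** Eliminating the modulus lets [lia] decide rim adjacency. *)
Lemma eq_ordS m (i j : 'I_m) :
  (j == ordS i) = ((i.+1 == m) && (j == 0 :> nat) || (j == i.+1 :> nat)).
Proof.
rewrite -val_eqE /=; have := ltn_ord i; have := ltn_ord j.
have [->|neq_m] := eqVneq i.+1 m; first by rewrite modnn; lia.
by move=> lt_j lt_i; rewrite modn_small; lia.
Qed.

(** * Convex hulls in the wheel *)

Section Wheel.
Variables (m : nat) (m_ge4 : 4 <= m).

Definition rim_indep (P : {set option 'I_m}) : bool :=
  [forall i, ~~ ((Some i \in P) && (Some (ordS i) \in P))].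

(* Unlike in the wheel, the center is isolated: it never prevents a move. *)
Definition near (x y : option 'I_m) : bool :=
  match x, y with
  | Some i, Some j => [|| i == j, j == ordS i | i == ordS j]
  | None, None => true
  | _, _ => false
  end.

Lemma near_refl : reflexive near.
Proof. by case=> [i|] //=; rewrite eqxx. Qed.

Lemma near_sym : symmetric near.
Proof. by move=> [i|] [j|] //=; rewrite eq_sym [(j == ordS i) || _]orbC. Qed.

Notation e := (wheel m.+1 : rel (option 'I_m)).

(** Distinct nonadjacent vertices both lie on the rim. A deleted vertex between them would need both
    its rim neighbours as endpoints, but one of these is deleted too. *)
Lemma convex_delete_rim_edge (i : 'I_m) :
  convex e (~: [set Some i; Some (ordS i)]).
Proof.
have inj_Some (a b : 'I_m) : (Some a == Some b) = (a == b) by [].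
move=> x y xK yK p sp_p.
have diam2 : x != y -> ~~ e x y -> e x None && e None y.
  by case: x y {xK yK sp_p} => [j|] [k|].
have [sub_p z|[z -> [neq_xy nexy xz zy]] u] := shortest_pathP diam2 sp_p.
  by move/sub_p; rewrite [z \in _]inE mem_seq1 => /orP[] /eqP ->.
rewrite [u \in _]inE => /orP[/eqP -> //|].
rewrite [u \in _]inE => /orP[/eqP ->|]; last by rewrite inE => /eqP ->.
move=> {sp_p diam2}; move: neq_xy xK yK nexy xz zy; case: z => [l|]; last by rewrite !inE.
case: x y => [j|] [k|] //=; rewrite !inE !inj_Some !negb_or => neq_jk.
move=> /andP[/negPf ji /negPf jsi] /andP[/negPf ki /negPf ksi] _ jl lk.
apply/andP; split; apply: contraNneq neq_jk => l_def; rewrite l_def in jl lk.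
  by move: jl lk; rewrite jsi ksi orbF => /eqP -> /eqP/ordS_inj ->.
move: jl lk; rewrite !(inj_eq (@ordS_inj m)) ![i == _]eq_sym ji ki orbF.
by move=> /eqP -> /eqP ->.
Qed.

(** Two adjacent rim vertices in [P] confine the hull to the convex set above. Otherwise each taken
    rim vertex lies midway between its untaken rim neighbours, which are nonadjacent as [m >= 4];
    then the center lies between rim vertices 0 and 2. *)
Lemma hull_wheel (P : {set option 'I_m}) :
  (hull e (~: P) == [set: option 'I_m]) = rim_indep P.
Proof.
apply/eqP/forallP => [hullT i|indP].
  apply/negP => /andP[iP siP].
  have /subsetP/(_ (Some i)) :
      hull e (~: P) \subset ~: [set Some i; Some (ordS i)].
    apply: hull_min; first exact: convex_delete_rim_edge.
    by rewrite setCS; apply/subsetP => x; rewrite !inE => /orP[] /eqP ->.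
  by rewrite hullT !inE eqxx => /(_ isT).
have H_convex := @hull_convex _ e (~: P).
have sub_H x : x \notin P -> x \in hull e (~: P).
  by move=> xP; apply: (subsetP (sub_hull e (~: P))); rewrite inE.
have rimH i : Some i \in hull e (~: P).
  have [iP|/sub_H //] := boolP (Some i \in P).
  have prevP := indP (ord_pred i); rewrite ord_predK iP andbT in prevP.
  have nextP := indP i; rewrite iP /= in nextP.
  have sp : shortest_path e (Some (ord_pred i)) (Some (ordS i))
                          [:: Some i; Some (ordS i)].
    have : i == ordS (ord_pred i) by rewrite ord_predK.
    have := eqxx (ordS i); rewrite [_ == ordS i]eq_ordS [_ == ordS (ord_pred i)]eq_ordS.
    move: (ord_pred i) (ordS i) => a b.
    have [[lt_a lt_b] lt_i] := (ltn_ord a, ltn_ord b, ltn_ord i) => ib ai.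
    by apply: shortest_path2; rewrite /= -?[Some _ == _]val_eqE ?eq_ordS /=; lia.
  apply: (H_convex _ _ (sub_H _ prevP) (sub_H _ nextP) _ sp).
  by rewrite !inE eqxx orbT.
apply/setP => -[i|]; rewrite in_setT; first exact: rimH.
have m_gt0 : 0 < m by lia.
have m_gt2 : 2 < m by lia.
have sp : shortest_path e (Some (Ordinal m_gt0)) (Some (Ordinal m_gt2))
                        [:: None; Some (Ordinal m_gt2)].
  by apply: shortest_path2; rewrite //= !eq_ordS /=; lia.
apply: (H_convex _ _ (rimH _) (rimH _) _ sp).
by rewrite !inE eqxx orbT.
Qed.

(** The board of the associated node Kayles: by [rim_indepU1], the moves that do not end the
    game. *)
Definition free (P : {set option 'I_m}) : {set option 'I_m} :=
  [set x | [forall y in P, ~~ near y x]].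

Lemma free_setU1 v P : free (v |: P) = free P :\: [set x | near v x].
Proof.
apply/setP => x; rewrite !inE.
apply/forall_inP/andP => [nvP|[nvx /forall_inP nP] y].
  split; first by apply: nvP; rewrite !inE eqxx.
  by apply/forall_inP => y yP; apply: nvP; rewrite !inE yP orbT.
by rewrite !inE => /orP[/eqP -> //|]; apply: nP.
Qed.

Lemma free_notin P v : v \in free P -> v \notin P.
Proof.
rewrite inE => /forall_inP nP; apply/negP => /nP.
by rewrite near_refl.
Qed.

Lemma rim_indepU1 v P :
  rim_indep P -> v \notin P -> rim_indep (v |: P) = (v \in free P).
Proof.
move=> /forallP indP vP; rewrite inE; apply/forallP/forall_inP => [indvP y yP|nP i].
  case: v y vP yP indvP => [i|] [j|] //= iP jP indvP; last by rewrite jP in iP.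
  rewrite !negb_or; apply/and3P; split; apply/negP => /eqP ij.
  - by rewrite -ij jP in iP.
  - by move: (indvP j); rewrite -ij !inE eqxx jP orbT.
  - by move: (indvP i); rewrite -ij !inE eqxx jP orbT.
have inj_Some (x y : 'I_m) : (Some x == Some y) = (x == y) by [].
have nS (j : 'I_m) : j == ordS j = false.
  by rewrite eq_ordS; have := ltn_ord j; lia.
rewrite !inE; case: eqP => [i_v|_] /=.
  rewrite -i_v inj_Some eq_sym nS /=; apply/negP => /nP.
  by rewrite -i_v /= eqxx !orbT.
case: eqP => [i_v|_] /=; last exact: indP.
rewrite andbT; apply/negP => /nP.
by rewrite -i_v /= eqxx !orbT.
Qed.

(** * Nim-values of positions on the wheel *)

Lemma ter_nim_terminal P : ~~ rim_indep P -> ter_nim e P = 0.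
Proof.
move=> /negPf indP; rewrite ter_nimE /ter_options hull_wheel indP.
exact: mex_unique.
Qed.

Lemma ter_nim_options P : rim_indep P ->
  ter_nim e P = mex [seq ter_nim e (v |: P) | v <- enum (~: P)].
Proof. by move=> indP; rewrite ter_nimE /ter_options hull_wheel indP -map_comp. Qed.

Lemma ter_nim_free P i : rim_indep P -> Some i \in P ->
  ter_nim e P = (node_kayles near (free P)).+1.
Proof.
have [l] := ubnP #|~: P|; elim: l => // l IHl in P * => lt_l indP iP.
have IH v : v \in free P -> ter_nim e (v |: P) =
    (node_kayles near (free P :\: [set x | near v x])).+1.
  move=> v_free; have vP := free_notin v_free.
  rewrite IHl ?free_setU1 ?rim_indepU1 ?in_setU ?iP ?orbT //.
  rewrite -ltnS (leq_trans _ lt_l) // ltnS; apply: proper_card; apply/properP.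
  by split; [rewrite setCS subsetUr|exists v; rewrite !inE ?eqxx].
rewrite ter_nim_options // (node_kaylesE near_refl) -mex_cons0 -map_comp.
(* Taking this rim neighbour ends the game, which supplies the option of value 0 required by
   [mex_cons0]. *)
have siP : Some (ordS i) \notin P by have /forallP/(_ i) := indP; rewrite iP.
apply: eq_mem_mex => k; rewrite inE; apply/mapP/orP => [[v]|[/eqP ->|/mapP[v]]].
- rewrite mem_enum inE => vP ->; have [v_free|vn] := boolP (v \in free P).
    by right; apply/mapP; exists v; rewrite ?mem_enum ?IH.
  by left; rewrite ter_nim_terminal // rim_indepU1.
- exists (Some (ordS i)); first by rewrite mem_enum inE.
  rewrite ter_nim_terminal // rim_indepU1 // inE; apply/forall_inP => /(_ _ iP).
  by rewrite /= eqxx orbT.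
by rewrite mem_enum => v_free ->; exists v; rewrite ?mem_enum ?inE ?free_notin ?IH.
Qed.

Lemma rim_indep0 : rim_indep set0.
Proof. by apply/forallP => i; rewrite !inE. Qed.

Lemma free0 : free set0 = setT.
Proof. by apply/setP => x; rewrite !inE; apply/forall_inP => y; rewrite inE. Qed.

Lemma rim_indep1 v : rim_indep [set v].
Proof. by rewrite -[[set v]]setU0 rim_indepU1 ?free0 ?inE ?rim_indep0. Qed.

Lemma free_rim1 (i : 'I_m) :
  node_kayles near (free [set Some i]) = Nat.lxor 1 (kayles (m - 3)).
Proof.
have m_gt0 : 0 < m by lia.
(* The remaining path runs around the rim from [i + 2] to [i - 2], hence has [m - 3] vertices. The
   isolated center contributes the nim-summand 1. *)
pose f t : option 'I_m := Some (Ordinal (ltn_pmod (i + 2 + t) m_gt0)).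
have fE t : t < m - 3 ->
    (i + 2 + t) %% m = if i + 2 + t < m then i + 2 + t else i + 2 + t - m.
  have := ltn_ord i; case: ifP => [lt_t|ge_t] lt_i lt_tm; first exact: modn_small.
  by rewrite -[in LHS](@subnK m (i + 2 + t)) ?modnDr ?modn_small //; lia.
have f_path s t : s < m - 3 -> t < m - 3 ->
    near (f s) (f t) = (s <= t.+1) && (t <= s.+1).
  move=> lt_s lt_t; rewrite /= !eq_ordS -val_eqE /= !fE //.
  by have := ltn_ord i; case: ifP; case: ifP; lia.
have -> : free [set Some i] = [set None] :|: [set x in map f (iota 0 (m - 3))].
  apply/setP => -[j|]; rewrite !inE; last by apply/forall_inP => y; rewrite inE => /eqP ->.
  apply/forall_inP/mapP => [/(_ (Some i))|[t]].
    rewrite inE eqxx => /(_ isT); rewrite /= !eq_ordS -val_eqE /= => nij.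
    have [lt_i lt_j] := (ltn_ord i, ltn_ord j).
    exists (if i + 2 <= j then j - i - 2 else j + m - i - 2).
      by rewrite mem_iota; case: ifP; lia.
    congr Some; apply: val_inj => /=.
    by case: ifP => le_j; rewrite fE; try case: ifP; lia.
  rewrite mem_iota => t_in [j_def] y; rewrite inE => /eqP ->.
  rewrite /= !eq_ordS -val_eqE j_def /= fE; last by lia.
  by have := ltn_ord i; case: ifP; lia.
rewrite (node_kaylesU near_refl near_sym) => [|x y]; last first.
  by rewrite !inE => /eqP -> /mapP[t _ ->].
by rewrite (node_kayles1 near_refl) (node_kayles_path near_refl near_sym f_path).
Qed.

Lemma ter_nim_rim1 (i : 'I_m) :
  ter_nim e [set Some i] = (Nat.lxor 1 (kayles (m - 3))).+1.
Proof. by rewrite (@ter_nim_free _ i) ?rim_indep1 ?inE // free_rim1. Qed.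

(** Every reply takes a rim vertex, after which [ter_nim_free] gives a successor; so no option has
    value 0. *)
Lemma ter_nim_center : ter_nim e [set None] = 0.
Proof.
rewrite ter_nim_options ?rim_indep1 //; apply: mex_unique => //.
apply/mapP => -[[i|]]; rewrite mem_enum !inE // => _.
rewrite (@ter_nim_free _ i) ?inE ?eqxx // rim_indepU1 ?rim_indep1 ?inE //.
by apply/forall_inP => y; rewrite inE => /eqP ->.
Qed.

(** By symmetry the options have only the values 0 and [(Nat.lxor 1 x).+1]; the latter is 1, making
    the mex 2, exactly when [x = 1]. *)
Lemma nim_TER_wheel :
  nim_TER e = if kayles (m - 3) == 1 then 2 else 1.
Proof.
rewrite /nim_TER ter_nim_options ?rim_indep0 //.
have m_gt0 : 0 < m by lia.
set x := kayles (m - 3).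
have -> : mex [seq ter_nim e (v |: set0) | v <- enum (~: (set0 : {set option 'I_m}))] =
          mex [:: 0; (Nat.lxor 1 x).+1].
  apply: eq_mem_mex => k; rewrite !inE; apply/mapP/orP => [[[i|] _ ->]|[] /eqP ->].
  - by right; rewrite setU0 ter_nim_rim1.
  - by left; rewrite setU0 ter_nim_center.
  - by exists None; rewrite ?mem_enum ?inE // setU0 ter_nim_center.
  by exists (Some (Ordinal m_gt0)); rewrite ?mem_enum ?inE // setU0 ter_nim_rim1.
case: eqP => [->|/eqP x_neq1]; first by rewrite mex_find.
apply: mex_unique => [|[|k]] //; rewrite !inE /= eqSS eq_sym.
apply: contra x_neq1 => /eqP lxor0; apply/eqP/esym; exact: Nat.lxor_eq.
Qed.

End Wheel.

Theorem theorem5p29 (n : nat) (hn : 5 <= n) :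
  nim_TER (wheel n) =
  if n %% 34 \in [:: 5; 6; 10; 11; 25; 26; 30; 31] then 2 else 1.
Proof.
case: n hn => // m m_ge4; rewrite nim_TER_wheel // kayles_eq1.
(* Here [m - 3 = n - 4], so the residues of [kayles_eq1] are shifted by 4. *)
congr (if _ then _ else _); rewrite !inE; lia.
Qed.
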